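(* Let $\mathcal{H}$ and $\mathcal{G}$ be real Hilbert spaces, let $(L_n)_{n\in\mathbb{N}}$ and $L$ be bounded linear operators from $\mathcal{H}$ to $\mathcal{G}$, let $B\colon\mathcal{G}\to2^{\mathcal{G}}$ be maximally monotone, and let $(\gamma_n)_{n\in\mathbb{N}}$ be a sequence in $(0,+\infty)$. Suppose that $L_n\to L$ in operator norm and that $\|L_n\|\leq 1$ for every $n\in\mathbb{N}$. Then the following hold: (i) Suppose that $\gamma_n\downarrow 0$. Then (a) $(L_n\diamond(\gamma_nB))_{n\in\mathbb{N}}$ graph-converges to $L\diamond N_{\overline{\operatorname{dom}}B}$; (b) $(L_n\bullet(\gamma_nB))_{n\in\mathbb{N}}$ graph-converges to $L\bullet N_{\overline{\operatorname{dom}}B}$. (ii) Suppose that $\gamma_n\uparrow+\infty$ and that $\operatorname{zer}B\neq\varnothing$. Then (a) $(L_n\diamond(\gamma_nB))_{n\in\mathbb{N}}$ graph-converges to $L\diamond N_{\operatorname{zer}B}$; (b) $(L_n\bullet(\gamma_nB))_{n\in\mathbb{N}}$ graph-converges to $L\bullet N_{\operatorname{zer}B}$.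
   Context: A set-valued operator $A\colon\mathcal{H}\to2^{\mathcal{H}}$ has graph $\operatorname{gra}A=\{(x,x^* )\mid x^*\in Ax\}$; it is maximally monotone if it is monotone ($\langle x_1-x_2\mid x_1^*-x_2^*\rangle\geq 0$ for all $(x_1,x_1^* ),(x_2,x_2^* )\in\operatorname{gra}A$) and its graph is not properly contained in the graph of another monotone operator. $\operatorname{dom}A=\{x\mid Ax\neq\varnothing\}$, $\overline{\operatorname{dom}}A$ is its closure, and $\operatorname{zer}A=\{x\mid 0\in Ax\}$. $N_C$ is the normal cone operator of a nonempty convex set $C$: $N_Cx=\{u\mid\langle y-x\mid u\rangle\leq 0\ \forall y\in C\}$ if $x\in C$, and $N_Cx=\varnothing$ otherwise (for $B$ maximally monotone, $\overline{\operatorname{dom}}B$ and $\operatorname{zer}B$ are closed and convex). $A^{-1}$ is defined by $x\in A^{-1}x^*\Leftrightarrow x^*\in Ax$. Sums, scalar multiples and compositions are pointwise, e.g. $(L^*\circ C\circ L)x=\{L^*y\mid y\in C(Lx)\}$. For a bounded linear $L\colon\mathcal{H}\to\mathcal{G}$ with adjoint $L^*$ and $C\colon\mathcal{G}\to2^{\mathcal{G}}$, the parallel composition is $L^*\triangleright C=(L^*\circ C^{-1}\circ L)^{-1}\colon\mathcal{H}\to2^{\mathcal{H}}$. The resolvent composition with parameter $1$ is $L\diamond C=L^*\triangleright(C+\mathrm{Id}_{\mathcal{G}})-\mathrm{Id}_{\mathcal{H}}$, and the resolvent cocomposition with parameter $1$ is $L\bullet C=(L\diamond C^{-1})^{-1}$.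 Graph-convergence: for a sequence $(C_n)_{n\in\mathbb{N}}$ of subsets of a Hilbert space, the lower limit is the set of $x$ for which there exist $x_n\in C_n$ (for all $n\in\mathbb{N}$) with $x_n\to x$ (strongly); the upper limit is the set of $x$ for which there exist a strictly increasing sequence $(k_n)_{n\in\mathbb{N}}$ in $\mathbb{N}$ and points $x_n\in C_{k_n}$ with $x_n\to x$. The sequence converges in the Painlevé–Kuratowski sense if the two coincide, the common set being its limit. Operators $(A_n)_{n\in\mathbb{N}}$ graph-converge to $A$ if $(\operatorname{gra}A_n)_{n\in\mathbb{N}}$ converges to $\operatorname{gra}A$ in this sense in $\mathcal{H}\times\mathcal{H}$. *)

(* Defs.v *)
From HB Require Import structures.
From mathcomp Require Import all_boot all_order all_algebra.
From mathcomp Require Import all_classical all_reals all_analysis.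
Set Implicit Arguments.
Unset Strict Implicit.
Unset Printing Implicit Defensive.
Import Order.TTheory GRing.Theory Num.Theory.
Import numFieldNormedType.Exports.
Local Open Scope classical_set_scope.
Local Open Scope ring_scope.

(* A real Hilbert space: a Banach space whose norm is induced by an inner
   product.  [{dot V for idfun}] is the type of symmetric positive definite
   bilinear forms on V. *)
HB.mixin Record CompleteNormedModule_isHilbert (R : realType) V
    of CompleteNormedModule R V := {
  inner : {dot V for idfun} ;
  inner_norm : forall x : V, inner x x = `|x| ^+ 2
}.

#[short(type="hilbertType")]
HB.structure Definition Hilbert (R : realType) :=
  { V of CompleteNormedModule R V & CompleteNormedModule_isHilbert R V }.

Notation "<| x , y |>" := (inner x y)
  (at level 0, x, y at level 99, format "<| x ,  y |>") : ring_scope.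

Definition opnorm (R : realType) (V W : normedModType R) (f : V -> W) : R :=
  sup [set `|f x| | x in [set x | `|x| <= 1]].

(* The equation determines z; for bounded linear f a solution exists by the
   Riesz representation theorem. *)
Definition adjoint (R : realType) (H G : hilbertType R) (f : H -> G) : G -> H :=
  fun y => xget 0 [set z | forall x, <| f x, y |> = <| x, z |>].

Section SetValuedOperators.
Context {R : realType}.
Implicit Types H G : hilbertType R.

Definition gra H G (A : H -> set G) : set (H * G) := [set p | A p.1 p.2].

Definition dom H G (A : H -> set G) : set H := [set x | A x !=set0].

Definition zer H G (A : H -> set G) : set H := [set x | A x 0].

Definition op_inv H G (A : H -> set G) : G -> set H := fun u => [set x | A x u].

Definition op_id H : H -> set H := fun x => [set x].

Definition op_add H G (A B : H -> set G) : H -> set G :=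
  fun x => [set u + v | u in A x & v in B x].

Definition op_sub H G (A B : H -> set G) : H -> set G :=
  fun x => [set u - v | u in A x & v in B x].

Definition op_scale H G (c : R) (A : H -> set G) : H -> set G :=
  fun x => [set c *: u | u in A x].

Definition monotone H (A : H -> set H) : Prop :=
  forall p q, gra A p -> gra A q -> 0 <= <| p.1 - q.1, p.2 - q.2 |>.

Definition maximally_monotone H (A : H -> set H) : Prop :=
  monotone A /\ forall A' : H -> set H, monotone A' -> ~ (gra A `<` gra A').

Definition normal_cone H (C : set H) : H -> set H :=
  fun x => [set u | C x /\ forall y, C y -> <| y - x, u |> <= 0].

(* [parallel_comp f C] is the operator written L^* |> C when f = L. *)
Definition parallel_comp H G (f : H -> G) (C : G -> set G) : H -> set H :=
  op_inv (fun x => [set adjoint f y | y in op_inv C (f x)]).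

Definition resolvent_comp H G (f : H -> G) (C : G -> set G) : H -> set H :=
  op_sub (parallel_comp f (op_add C (@op_id G))) (@op_id H).

Definition resolvent_cocomp H G (f : H -> G) (C : G -> set G) : H -> set H :=
  op_inv (resolvent_comp f (op_inv C)).

End SetValuedOperators.

Section PainleveKuratowski.
Context {T : topologicalType}.
Implicit Type C : nat -> set T.

Definition lower_limit C : set T :=
  [set x | exists2 u : nat -> T, (forall n, C n (u n)) & u @ \oo --> x].

Definition upper_limit C : set T :=
  [set x | exists k : nat -> nat, {homo k : m n / (m < n)%N} /\
     exists2 u : nat -> T, (forall n, C (k n) (u n)) & u @ \oo --> x].

Definition pk_cvg C (D : set T) : Prop := lower_limit C = D /\ upper_limit C = D.

End PainleveKuratowski.

(* The max norm of the library on H * H induces the same topology as the norm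
   of the Hilbert direct sum. *)
Definition graph_cvg (R : realType) (H : hilbertType R)
    (A_ : nat -> H -> set H) (A : H -> set H) : Prop :=
  pk_cvg (fun n => gra (A_ n)) (gra A).

(* Main.v *)
(* Write J_C for the resolvent (Id + C)^-1. The resolvent composition of L and C
   has resolvent L^* o J_C o L, the cocomposition has resolvent
   Id - L^* o (Id - J_C) o L, and a graph is parametrized by its resolvent;
   hence graph convergence follows from pointwise convergence of uniformly
   Lipschitz resolvents. This reduces everything to the strong convergence of
   J_(gamma_n B) y. Since gamma_n is monotone, monotonicity of B gives
   |J_m y - J_n y|^2 <= | |y - J_n y|^2 - |y - J_m y|^2 | with |y - J_n y| monotone
   and bounded, so the sequence is Cauchy and no weak compactness is needed.
   Minty's theorem and the Riesz representation both come from the minimization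
   of a closed convex function plus half the squared norm. *)
Require Import Defs.
From HB Require Import structures.
From mathcomp Require Import all_boot all_order all_algebra.
From mathcomp Require Import all_classical all_reals all_analysis.
From mathcomp Require Import ring lra.
Import Order.TTheory GRing.Theory Num.Theory.
Import numFieldNormedType.Exports.
Local Open Scope classical_set_scope.
Local Open Scope ring_scope.
Set Implicit Arguments.
Unset Strict Implicit.
Unset Printing Implicit Defensive.

(** * Inner product calculus and continuity *)

Section InnerProduct.
Context {R : realType} {H : hilbertType R}.
Implicit Types (x y z : H) (a : R).

Lemma innerC x y : <| x, y |> = <| y, x |>.
Proof. by rewrite hermC expr0 mul1r. Qed.

Lemma innerDl x y z : <| x + y, z |> = <| x, z |> + <| y, z |>.
Proof. exact: linearDl. Qed.

Lemma innerDr x y z : <| z, x + y |> = <| z, x |> + <| z, y |>.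
Proof. exact: linearDr. Qed.

Lemma innerNl x z : <| - x, z |> = - <| x, z |>.
Proof. exact: linearNl. Qed.

Lemma innerNr x z : <| z, - x |> = - <| z, x |>.
Proof. exact: linearNr. Qed.

Lemma innerZl a x z : <| a *: x, z |> = a * <| x, z |>.
Proof. exact: linearZl_LR. Qed.

Lemma innerZr a x z : <| z, a *: x |> = a * <| z, x |>.
Proof. exact: linearZr_LR. Qed.

Lemma inner0l z : <| 0, z |> = 0.
Proof. exact: linear0l. Qed.

Lemma inner0r z : <| z, 0 |> = 0.
Proof. exact: linear0r. Qed.

Definition innerE := (innerDl, innerDr, innerNl, innerNr, innerZl, innerZr).

Lemma inner_ge0 x : 0 <= <| x, x |>.
Proof. by rewrite inner_norm exprn_ge0. Qed.

Lemma inner_le0 x : <| x, x |> <= 0 -> x = 0.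
Proof.
rewrite inner_norm => x0; apply/eqP; rewrite -normr_eq0 -sqrf_eq0.
by rewrite eq_le x0 exprn_ge0.
Qed.

(** Squaring the triangle inequality and cancelling both squared norms leaves twice the claim. *)
Lemma cauchy_schwarz x y : <| x, y |> <= `|x| * `|y|.
Proof.
have : `|x + y| ^+ 2 <= (`|x| + `|y|) ^+ 2 by rewrite ler_sqr ?nnegrE ?addr_ge0 ?ler_normD.
rewrite -inner_norm !innerE !inner_norm [<| y, x |>]innerC; nra.
Qed.

(** Polarization reduces this to continuity of the norm. *)
Lemma cvg_inner (u v : nat -> H) x y : u @ \oo --> x -> v @ \oo --> y ->
  (fun n => <| u n, v n |>) @ \oo --> <| x, y |>.
Proof.
have polar (a b : H) : <| a, b |> = 2^-1 * (`|a + b| ^+ 2 - `|a| ^+ 2 - `|b| ^+ 2).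
  by rewrite -!inner_norm !innerE [<| b, a |>]innerC; field.
move=> ux vy; rewrite polar; under eq_fun do rewrite polar.
have sq (w : nat -> H) z : w @ \oo --> z -> (fun n => `|w n| ^+ 2) @ \oo --> `|z| ^+ 2.
  by move=> wz; under eq_fun do rewrite expr2; rewrite expr2; apply: cvgM; apply: cvg_norm.
apply: cvgM; first exact: cvg_cst.
by apply: cvgB; [apply: cvgB|]; apply: sq => //; apply: cvgD.
Qed.

End InnerProduct.

(** * Minimization over closed convex epigraphs; Riesz representation *)

Lemma cvgn_sqr_dist (R : realType) (V : completeNormedModType R)
    (u : nat -> V) (a : nat -> R) :
  a @ \oo --> 0 -> (forall m n, (m <= n)%N -> `|u m - u n| ^+ 2 <= a m) ->
  cvgn u.
Proof.
move=> a0 ua; apply/cauchy_cvgP/cauchy_exP => e e0; rewrite /fmapE.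
have [N _ aN] : \forall n \near \oo, a n < e ^+ 2.
  exact: (cvgr_lt _ a0 _ (exprn_gt0 2 e0)).
exists (u N), N => // n Nn; rewrite -ball_normE /ball_ /=.
rewrite -ltr_sqr ?nnegrE ?(ltW e0)//.
exact: le_lt_trans (ua _ _ Nn) (aN N (leqnn N)).
Qed.

Lemma ge0_of_affine_ge0 (R : realType) (a b : R) :
  (forall s, 0 < s -> s <= 1 -> 0 <= a + s * b) -> 0 <= a.
Proof.
move=> ab; rewrite leNgt; apply/negP => a0.
have b0 := normr_ge0 b; have bb := ler_norm b.
have d0 : 0 < `|b| - a by lra.
(* With this [s], the product of [s] and the absolute value of [b] is below [- a / 2], so
   [a + s * b] stays below [a / 2 < 0]. *)
pose s := - a / (2 * (`|b| - a)).
have s0 : 0 < s by rewrite divr_gt0 ?mulr_gt0 //; lra.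
have sE : s * (`|b| - a) = - a / 2 by rewrite /s; field; rewrite gt_eqF.
have s1 : s <= 1 by rewrite /s ler_pdivrMr ?mulr_gt0//; lra.
have := ab s s0 s1; nra.
Qed.

(* E stands for the epigraph of a closed convex function F on H1 * H2. A
   minimizing sequence of F plus half the squared norm is Cauchy by the
   parallelogram law; the conclusion is the first-order optimality condition at
   the minimizer (x, u). *)
Lemma epigraph_optimality (R : realType) (H1 H2 : hilbertType R)
    (E : H1 -> H2 -> R -> Prop) (m : R) :
  (exists x u t, E x u t) ->
  (forall x u t, E x u t -> m <= t + 2^-1 * (<| x, x |> + <| u, u |>)) ->
  (forall s x u t x' u' t', 0 <= s -> s <= 1 -> E x u t -> E x' u' t' ->
    E ((1 - s) *: x + s *: x') ((1 - s) *: u + s *: u') ((1 - s) * t + s * t')) ->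
  (forall x_ u_ t_ x u t, (forall n : nat, E (x_ n) (u_ n) (t_ n)) ->
    x_ @ \oo --> x -> u_ @ \oo --> u -> t_ @ \oo --> t -> E x u t) ->
  exists x u t, E x u t /\ forall x' u' t', E x' u' t' ->
    t + <| x, x |> + <| u, u |> <= t' + <| x', x |> + <| u', u |>.
Proof.
move=> [xe [ue [te Ee]]] Elb Ecvx Ecl.
pose phi (x : H1) (u : H2) (t : R) := t + 2^-1 * (<| x, x |> + <| u, u |>).
pose S := [set r | exists x u t, E x u t /\ r = phi x u t].
have Sinf : has_inf S.
  split; first by exists (phi xe ue te); exists xe, ue, te.
  by exists m => _ [x [u [t [/Elb + ->]]]].
have Sle x u t : E x u t -> inf S <= phi x u t.
  by move=> Ex; apply: ge_inf; [case: Sinf|exists x, u, t].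
have : forall n : nat, exists p : H1 * H2 * R, E p.1.1 p.1.2 p.2 /\
    phi p.1.1 p.1.2 p.2 < inf S + n.+1%:R^-1.
  move=> n; have n0 : 0 < n.+1%:R^-1 :> R by rewrite invr_gt0.
  have [_ [x [u [t [Ex ->]]]] lt] := inf_adherent n0 Sinf.
  by exists (x, u, t).
move=> /choice[p pP].
pose x_ n := (p n).1.1; pose u_ n := (p n).1.2; pose t_ n := (p n).2.
have Ep n : E (x_ n) (u_ n) (t_ n) by case: (pP n).
have php n : phi (x_ n) (u_ n) (t_ n) < inf S + n.+1%:R^-1 by case: (pP n).
have inv0 : (fun n : nat => 8 * n.+1%:R^-1) @ \oo --> (0 : R).
  rewrite -(mulr0 (8 : R)); apply: cvgM; first exact: cvg_cst.
  exact: cvg_harmonic.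
(* The midpoint of the points [i] and [j] is in [E]. By the parallelogram law its [phi] is the mean
   of theirs minus 1/8 of the squared distance, whence the factor 8. *)
have gap i j : (i <= j)%N ->
    <| x_ i - x_ j, x_ i - x_ j |> + <| u_ i - u_ j, u_ i - u_ j |> <= 8 * i.+1%:R^-1.
  move=> ij.
  have h0 : 0 <= 2^-1 :> R by lra.
  have h1 : 2^-1 <= 1 :> R by lra.
  have /Sle := Ecvx _ _ _ _ _ _ _ h0 h1 (Ep i) (Ep j).
  have := php i; have := php j.
  have : j.+1%:R^-1 <= i.+1%:R^-1 :> R by rewrite lef_pV2 ?posrE// ler_nat ltnS.
  rewrite /phi !innerE [<| x_ j, x_ i |>]innerC [<| u_ j, u_ i |>]innerC.
  by move: (i.+1%:R^-1) (j.+1%:R^-1) => a b *; lra.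
have xc : cvgn x_.
  apply: cvgn_sqr_dist inv0 _ => i j /gap.
  by rewrite -inner_norm; apply: le_trans; rewrite lerDl inner_ge0.
have uc : cvgn u_.
  apply: cvgn_sqr_dist inv0 _ => i j /gap.
  by rewrite -inner_norm; apply: le_trans; rewrite lerDr inner_ge0.
pose x := limn x_; pose u := limn u_.
(* The only possible limit of [t_]: it makes [phi x u t] equal to [inf S]. *)
pose t := inf S - 2^-1 * (<| x, x |> + <| u, u |>).
have qc : (fun n => 2^-1 * (<| x_ n, x_ n |> + <| u_ n, u_ n |>)) @ \oo -->
    2^-1 * (<| x, x |> + <| u, u |>).
  by apply: cvgM; [exact: cvg_cst|apply: cvgD; apply: cvg_inner].
have phc : (fun n => phi (x_ n) (u_ n) (t_ n)) @ \oo --> inf S.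
  apply: (@squeeze_cvgr _ _ _ _ (cst (inf S)) (fun n => inf S + n.+1%:R^-1)).
  - by near=> n; rewrite /= Sle //= ltW.
  - exact: cvg_cst.
  - by rewrite -[X in _ --> X]addr0; apply: cvgD; [exact: cvg_cst|exact: cvg_harmonic].
have tc : t_ @ \oo --> t.
  have -> : t_ = fun n => phi (x_ n) (u_ n) (t_ n) -
      2^-1 * (<| x_ n, x_ n |> + <| u_ n, u_ n |>).
    by apply/funext => n; rewrite /phi addrK.
  exact: cvgB.
have Ex : E x u t by apply: Ecl Ep xc uc tc.
exists x, u, t; split=> // x' u' t' Ex'.
have : 0 <= t' - t + (<| x', x |> - <| x, x |>) + (<| u', u |> - <| u, u |>).
  (* Minimality along the segment towards [(x', u', t')]: the increment of [phi] is at most [s]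
     times the first-order term plus [s ^+ 2] times this coefficient. Divide by [s] and let it tend
     to 0. *)
  apply: (@ge0_of_affine_ge0 _ _ (2^-1 * (<| x - x', x - x' |> + <| u - u', u - u' |>))).
  move=> s s0 s1; rewrite -(pmulr_rge0 _ s0).
  have /Sle := Ecvx _ _ _ _ _ _ _ (ltW s0) s1 Ex Ex'.
  rewrite -[inf S](subrK (2^-1 * (<| x, x |> + <| u, u |>))) -/t /phi.
  rewrite !innerE [<| x, x' |>]innerC [<| u, u' |>]innerC; nra.
lra.
Unshelve. all: by end_near.
Qed.

(** At a minimizer [x] of [f] plus half the squared norm, the linear map [f y + <| y, x |>] is
    bounded below, hence zero, so [- x] represents [f]. The second variable of the epigraph is a
    dummy. *)
Lemma riesz (R : realType) (H : hilbertType R) (f : {scalar H}) (M : R) :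
  (forall x, `|f x| <= M * `|x|) -> exists z, forall x, f x = <| x, z |>.
Proof.
move=> fM.
have [||||x [u [t [ft opt]]]] :=
    @epigraph_optimality R H H (fun x _ t => f x <= t) (- (M ^+ 2 / 2)).
- by exists 0, 0, (f 0).
- move=> x u t ft; have := inner_ge0 u; have := fM x; rewrite [<| x, x |>]inner_norm.
  have := ler_norm (- f x); rewrite normrN; have := sqr_ge0 (M - `|x|).
  move=> *; nra.
- move=> s x u t x' u' t' s0 s1 ft ft'; rewrite linearD !linearZ /=.
  by rewrite lerD // ler_wpM2l //; lra.
- move=> x_ u_ t_ x u t Ef xc _ tc.
  have fc : (fun n => f (x_ n)) @ \oo --> f x.
    apply/cvgrPdist_le => e e0.
    have d0 : 0 < e / (`|M| + 1) by rewrite divr_gt0 // ltr_wpDl.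
    have /cvgrPdist_le/(_ _ d0) := xc; apply: filterS => n xn.
    rewrite -linearB; apply: le_trans (fM _) _.
    rewrite ler_pdivlMr ?ltr_wpDl// in xn.
    have := ler_norm M; have := normr_ge0 (x - x_ n); nra.
  by apply: ler_cvg_to fc tc _; near=> n; apply: Ef.
exists (- x) => y.
have opt' (z : H) : t + <| x, x |> + <| u, u |> <= f z + <| z, x |>.
  by have := opt z 0 (f z) (lexx _); rewrite inner0l addr0.
have opt0 := opt' 0; rewrite linear0 inner0l addr0 in opt0.
apply/eqP; rewrite innerNr -subr_eq0 opprK; apply/negPn/negP => fy.
(* The multiple of [y] at which this linear map equals its lower bound minus 1. *)
have := opt' ((t + <| x, x |> + <| u, u |> - 1) / (f y + <| y, x |>) *: y).
by rewrite linearZ /= innerZl -mulrDr divfK//; lra.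
Unshelve. all: by end_near.
Qed.

Lemma ler_opnorm (R : realType) (V W : normedModType R) (f : {linear V -> W}) :
  bounded_fun_norm f -> forall x, `|f x| <= opnorm f * `|x|.
Proof.
move=> /(_ 1)[M fM] x.
have [->|x0] := eqVneq x 0; first by rewrite linear0 !normr0 mulr0.
have nx0 : 0 < `|x| by rewrite normr_gt0.
rewrite -ler_pdivrMr//.
have -> : `|f x| / `|x| = `|f (`|x|^-1 *: x)|.
  by rewrite linearZ normrZ mulrC ger0_norm// invr_ge0 ltW.
apply: ub_le_sup; first by exists M => _ [y /= y1 <-]; exact: fM.
exists (`|x|^-1 *: x) => //=.
by rewrite normrZ ger0_norm ?invr_ge0 ?(ltW nx0)// mulVf// gt_eqF.
Qed.

(** * Adjoints of bounded operators *)

Section Adjoint.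
Context {R : realType} {H G : hilbertType R}.
Implicit Types (f g : {linear H -> G}) (x : H) (y : G) (M : R).

(** The bound makes [<| f x, y |>] a bounded functional of [x], so by Riesz the [xget] in [adjoint]
    returns a genuine solution, not the default 0. *)
Lemma adjointE f M : (forall x, `|f x| <= M * `|x|) ->
  forall x y, <| f x, y |> = <| x, adjoint f y |>.
Proof.
move=> fM x y; rewrite /adjoint.
have lin : linear_for *%R (fun x => <| f x, y |>).
  by move=> a u v; rewrite linearP !innerE.
pose h : {scalar H} := HB.pack (fun x => <| f x, y |>)
  (GRing.isLinear.Build _ _ _ _ _ lin).
have [z zP] : exists z, forall x, h x = <| x, z |>.
  apply: (@riesz _ _ h (M * `|y|)) => u /=.
  rewrite mulrAC ler_norml; apply/andP; split.
    rewrite lerNl -innerNl; apply: le_trans (cauchy_schwarz _ _) _.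
    by rewrite normrN ler_wpM2r.
  by apply: le_trans (cauchy_schwarz _ _) _; rewrite ler_wpM2r.
by case: xgetP => [w _ -> //|/(_ z)]; case.
Qed.

(** Pair the difference [w] with itself and move [f] and [g] onto [w]. The case [f = g], [e = 0]
    gives Lipschitz bounds; [g] the limit of operators [f] gives convergence. *)
Lemma ler_adjoint_dist f g M N e y y' :
  0 <= M -> 0 <= e -> (forall x, `|f x| <= M * `|x|) -> (forall x, `|g x| <= N * `|x|) ->
  (forall x, `|f x - g x| <= e * `|x|) ->
  `|adjoint f y - adjoint g y'| <= M * `|y - y'| + e * `|y'|.
Proof.
move=> M0 e0 fM gN fge; set w := adjoint f y - adjoint g y'.
have [->|w0] := eqVneq w 0.
  by rewrite normr0 addr_ge0 // mulr_ge0.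
have nw0 : 0 < `|w| by rewrite normr_gt0.
rewrite -(ler_pM2l nw0) -expr2 -inner_norm {2}/w innerDr innerNr.
rewrite -(adjointE fM) -(adjointE gN).
have -> : <| f w, y |> - <| g w, y' |> = <| f w, y - y' |> + <| f w - g w, y' |>.
  by rewrite !innerE; ring.
rewrite mulrDr; apply: lerD; apply: le_trans (cauchy_schwarz _ _) _.
  by rewrite mulrCA mulrA ler_wpM2r.
by rewrite mulrCA mulrA ler_wpM2r.
Qed.

End Adjoint.

(** * Maximal monotonicity and Minty's theorem *)

Section MaximallyMonotone.
Context {R : realType} {G : hilbertType R}.
Implicit Types (A B : G -> set G).

Lemma monotoneP A : Defs.monotone A <->
  forall x u y v, A x u -> A y v -> 0 <= <| x - y, u - v |>.
Proof.
split=> [mA x u y v Axu Ayv|mA [x u] [y v]]; last exact: mA.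
exact: (mA (x, u) (y, v)).
Qed.

(** Otherwise adjoining [(x, u)] to the graph would give a proper monotone extension. *)
Lemma maximally_monotoneP B : maximally_monotone B -> forall x u,
  (forall a b, B a b -> 0 <= <| x - a, u - b |>) -> B x u.
Proof.
move=> [/monotoneP mB maxB] x u rel; apply: contrapT => nB.
pose B' y := [set v | B y v \/ (y = x /\ v = u)].
apply: (maxB B').
  apply/monotoneP => y v y' v' [Bv|[-> ->]] [Bv'|[-> ->]].
  - exact: mB.
  - by rewrite -opprB innerNl -innerNr opprB rel.
  - exact: rel.
  - by rewrite !subrr inner0l.
split=> [[y v] /= ?|sub]; first by left.
by apply: nB; apply: (sub (x, u)); right.
Qed.

(* The minimizer (x, u) of the Fitzpatrick function of A plus half the squared
   norm satisfies - x \in A (- u), and the optimality condition at the point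
   (- u, - x) of the graph forces u = - x. *)
Lemma minty_zero A : Defs.monotone A ->
  (forall x u, (forall a b, A a b -> 0 <= <| x - a, u - b |>) -> A x u) ->
  exists x, A x (- x).
Proof.
move=> /monotoneP mA maxA.
pose E (x u : G) (t : R) :=
  forall a b, A a b -> <| x, b |> + <| a, u |> - <| a, b |> <= t.
(* The Fitzpatrick function dominates the pairing: if [t] were smaller, [(x, u)] would be
   monotonically related to the graph, hence in it, and testing [E] there is contradictory. *)
have E_ge x u t : E x u t -> <| x, u |> <= t.
  move=> Et; rewrite leNgt; apply/negP => tlt.
  have : A x u.
    apply: maxA => a b Aab; have := Et a b Aab.
    by rewrite !innerE; move=> *; lra.
  by move=> /Et; move=> *; lra.
have [x0 [u0 A0]] : exists x u, A x u.
  apply: contrapT => nA; apply: (nA); exists 0, 0; apply: maxA => a b Aab.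
  by exfalso; apply: nA; exists a, b.
have E_gra x u : A x u -> E x u <| x, u |>.
  by move=> Axu a b Aab; have := mA _ _ _ _ Axu Aab; rewrite !innerE => *; lra.
have [||||x [u [t [Et opt]]]] := @epigraph_optimality R G G E 0.
- by exists x0, u0, <| x0, u0 |>; exact: E_gra.
- move=> x u t /E_ge; have := inner_ge0 (x + u).
  by rewrite !innerE [<| u, x |>]innerC => *; lra.
- move=> s x u t x' u' t' s0 s1 Et Et' a b Aab.
  have := Et a b Aab; have := Et' a b Aab; rewrite !innerE => *; nra.
- move=> x_ u_ t_ x u t Et xc uc tc a b Aab.
  apply: (ler_cvg_to (f := fun n => <| x_ n, b |> + <| a, u_ n |> - <| a, b |>) _ tc).
  2: by near=> n; exact: Et.
  apply: cvgB; last exact: cvg_cst.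
  by apply: cvgD; apply: cvg_inner => //; exact: cvg_cst.
(* Optimality at [(a, b)] and [E_ge] bound [<| - u - a, - x - b |>] below by the squared norm of
   [x + u]. *)
have Aux : A (- u) (- x).
  apply: maxA => a b Aab; have := opt _ _ _ (E_gra _ _ Aab).
  have := E_ge _ _ _ Et; have := inner_ge0 (x + u).
  rewrite !innerE [<| u, x |>]innerC [<| b, u |>]innerC => *; lra.
have xu : x + u = 0.
  apply: inner_le0; have := opt _ _ _ (E_gra _ _ Aux); have := E_ge _ _ _ Et.
  by rewrite !innerE [<| u, x |>]innerC => *; lra.
have xE : x = - u by apply/eqP; rewrite -addr_eq0 xu.
by exists (- u); rewrite xE in Aux.
Unshelve. all: by end_near.
Qed.

Lemma minty B c : 0 < c -> maximally_monotone B ->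
  forall y, exists x b, B x b /\ y = x + c *: b.
Proof.
move=> c0 Bmax y; have /monotoneP mB := Bmax.1.
(* This is [c B - y], so [- x] in [A x] means that [y] is in [x + c B x]. *)
pose A x := [set u | B x (c^-1 *: (u + y))].
have [||x Ax] := @minty_zero A.
- apply/monotoneP => x u x' u' Bu Bu'; have := mB _ _ _ _ Bu Bu'.
  by rewrite -scalerBr opprD addrACA subrr addr0 innerZr pmulr_rge0 ?invr_gt0.
- move=> x u rel; apply: maximally_monotoneP Bmax _ _ _ => a b Bab.
  have := rel a (c *: b - y); rewrite /A /= subrK scalerA mulVf ?gt_eqF// scale1r.
  move=> /(_ Bab) rel0.
  have -> : c^-1 *: (u + y) - b = c^-1 *: (u - (c *: b - y)).
    by rewrite opprB addrA scalerBr scalerA mulVf ?gt_eqF// scale1r.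
  by rewrite innerZr mulr_ge0// invr_ge0 ltW.
exists x, (c^-1 *: (- x + y)); split=> //.
by rewrite scalerA mulfV ?gt_eqF// scale1r addrA subrr add0r.
Qed.

End MaximallyMonotone.

(** * Resolvents as parametrizations of graphs *)

(** Equivalently, the graph of [A] is the set of all [(J y, y - J y)], and [J] is the everywhere
    defined, single-valued inverse of [Id + A]. *)
Definition is_resolvent (R : realType) (H : hilbertType R)
    (A : H -> set H) (J : H -> H) := forall x u, A x u <-> x = J (x + u).

Section Resolvents.
Context {R : realType} {H : hilbertType R}.
Implicit Types (A : H -> set H) (J : H -> H).

(** Two graph points with the same sum [x + u] have opposite differences in their components, so
    monotonicity makes both differences vanish. *)
Lemma monotone_is_resolvent A J : Defs.monotone A ->
  (forall y, A (J y) (y - J y)) -> is_resolvent A J.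
Proof.
move=> /monotoneP mA AJ x u; split=> [Axu|xE]; last first.
  by have := AJ (x + u); rewrite -xE [x + u]addrC addrK.
apply/eqP; rewrite -subr_eq0; apply/eqP/inner_le0.
have := mA _ _ _ _ Axu (AJ (x + u)).
by rewrite !innerE => *; lra.
Qed.

Lemma is_resolvent_gra A J : is_resolvent A J -> forall y, A (J y) (y - J y).
Proof. by move=> AJ y; apply/AJ; rewrite addrC subrK. Qed.

(** Monotonicity gives firm nonexpansiveness, and Cauchy-Schwarz then removes one factor. *)
Lemma resolvent_nonexpansive A J : Defs.monotone A -> is_resolvent A J ->
  forall y y', `|J y - J y'| <= `|y - y'|.
Proof.
move=> /monotoneP mA /is_resolvent_gra AJ y y'.
have [->|d0] := eqVneq (J y - J y') 0; first by rewrite normr0.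
rewrite -(ler_pM2l (x := `|J y - J y'|)) ?normr_gt0//.
apply: le_trans (cauchy_schwarz _ _); rewrite -expr2 -inner_norm.
by have := mA _ _ _ _ (AJ y) (AJ y'); rewrite !innerE => *; lra.
Qed.

Lemma is_resolvent_inv A J : is_resolvent A J ->
  is_resolvent (op_inv A) (fun y => y - J y).
Proof.
move=> AJ u x; rewrite /op_inv /= AJ [x + u]addrC; split=> [xE|/eqP].
  by rewrite -xE addrK.
by rewrite eq_sym subr_eq => /eqP/addrI.
Qed.

Lemma normal_cone_monotone (C : set H) : Defs.monotone (normal_cone C).
Proof.
apply/monotoneP => x u y v [Cx xC] [Cy yC].
have := xC _ Cy; have := yC _ Cx; rewrite !innerE => *; lra.
Qed.

Lemma op_scale_monotone c A : 0 < c -> Defs.monotone A ->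
  Defs.monotone (op_scale c A).
Proof.
move=> c0 /monotoneP mA; apply/monotoneP => x _ y _ [u Au <-] [v Av <-].
by rewrite -scalerBr innerZr pmulr_rge0// mA.
Qed.

Lemma resolvent_exists c A : 0 < c -> maximally_monotone A ->
  exists J, is_resolvent (op_scale c A) J.
Proof.
move=> c0 Amax.
have : forall y, exists x, op_scale c A x (y - x).
  by move=> y; have [x [b [Ab ->]]] := minty c0 Amax y; exists x, b => //; rewrite addrC addKr.
move=> /choice[J JP]; exists J; apply: monotone_is_resolvent JP.
exact: op_scale_monotone Amax.1.
Qed.

End Resolvents.

(** Adding [Id] cancels the subtraction in the definition and leaves the inverse of [adjoint f]
    after [(C + Id)^-1] after [f], where [(C + Id)^-1] is [J]. *)
Lemma resolvent_comp_is_resolvent (R : realType) (H G : hilbertType R)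
    (f : {linear H -> G}) (C : G -> set G) J : is_resolvent C J ->
  is_resolvent (resolvent_comp f C) (adjoint f \o J \o f).
Proof.
move=> CJ x u; split=> [|xE].
  move=> [v [y]]; rewrite /op_inv /= => -[c Cyc [_ ->]] fv yv [_ ->] vu.
  have -> : x + u = v by rewrite -vu addrC subrK.
  rewrite -yv; congr (adjoint f _).
  by move/CJ : Cyc; rewrite addrC fv.
exists (x + u); last by exists x => //; rewrite addrC addKr.
exists (J (f (x + u))) => //.
exists (f (x + u) - J (f (x + u))); first exact: is_resolvent_gra CJ _.
by exists (J (f (x + u))) => //; rewrite subrK.
Qed.

(** * From resolvents to graph convergence *)

Lemma cvgn_dist_le (R : realType) (V : normedModType R) (u v : nat -> V) (l : V)
    (a : nat -> R) :
  v @ \oo --> l -> a @ \oo --> (0 : R) ->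
  (forall n, `|u n - v n| <= a n) -> u @ \oo --> l.
Proof.
move=> vl a0 uva.
have d0 : (fun n => u n - v n) @ \oo --> (0 : V).
  apply: norm_cvg0; apply: squeeze_cvgr (cvg_cst 0) a0.
  by near=> n; rewrite normr_ge0 uva.
have -> : u = fun n => u n - v n + v n by apply/funext => n; rewrite subrK.
by rewrite -[X in _ --> X]add0r; exact: cvgD.
Unshelve. all: by end_near.
Qed.

Lemma graph_cvg_of_resolvents (R : realType) (H : hilbertType R)
    (A_ : nat -> H -> set H) (A : H -> set H) (J_ : nat -> H -> H) (J : H -> H)
    (K : R) :
  (forall n, is_resolvent (A_ n) (J_ n)) -> is_resolvent A J ->
  (forall n y y', `|J_ n y - J_ n y'| <= K * `|y - y'|) ->
  (forall y, (fun n => J_ n y) @ \oo --> J y) ->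
  graph_cvg A_ A.
Proof.
move=> AJ_ AJ JK JJ.
have low : gra A `<=` lower_limit (fun n => gra (A_ n)).
  move=> [x u] Axu; have xE : x = J (x + u) by apply/AJ.
  (* The point of the graph of [A_ n] whose components have the same sum [x + u]. *)
  exists (fun n => (J_ n (x + u), x + u - J_ n (x + u))).
    by move=> n; exact: (is_resolvent_gra (AJ_ n)).
  have Jx : (fun n => J_ n (x + u)) @ \oo --> x by rewrite {2}xE.
  apply: cvg_pair => //=.
  have : (fun n => x + u - J_ n (x + u)) @ \oo --> x + u - x.
    by apply: cvgB => //; exact: cvg_cst.
  by rewrite [X in _ --> nbhs (X - _)]addrC addrK.
have lowup : lower_limit (fun n => gra (A_ n)) `<=` upper_limit (fun n => gra (A_ n)).
  by move=> p [w wA wp]; exists id; split=> //; exists w.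
have up : upper_limit (fun n => gra (A_ n)) `<=` gra A.
  move=> [x u] [k [kmono [w wA wxu]]]; apply/AJ.
  pose z n := (w n).1 + (w n).2.
  have w1 : (fun n => (w n).1) @ \oo --> x by apply: cvg_comp wxu _; exact: cvg_fst.
  have w2 : (fun n => (w n).2) @ \oo --> u by apply: cvg_comp wxu _; exact: cvg_snd.
  have zc : z @ \oo --> x + u by exact: cvgD.
  have wE n : (w n).1 = J_ (k n) (z n) by apply/AJ_; exact: wA.
  have kc : k @ \oo --> \oo.
    have kn n : (n <= k n)%N.
      by elim: n => // n IH; exact: leq_ltn_trans IH (kmono _ _ (ltnSn n)).
    by move=> P [N _ NP]; exists N => // n /= Nn; exact: NP (leq_trans Nn (kn n)).
  have Jk : (fun n => J_ (k n) (x + u)) @ \oo --> J (x + u).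
    exact: (cvg_comp _ _ kc (JJ (x + u))).
  (* The uniform constant [K] allows the moving argument [z n] to be replaced by its limit
     [x + u]. *)
  have w1J : (fun n => (w n).1) @ \oo --> J (x + u).
    apply: (cvgn_dist_le (a := fun n => K * `|z n - (x + u)|) Jk).
      rewrite -(mulr0 K); apply: cvgM; first exact: cvg_cst.
      by apply/norm_cvg0P; rewrite -(subrr (x + u)); apply: cvgB => //; exact: cvg_cst.
    by move=> n; rewrite wE.
  exact: (cvg_unique _ w1 w1J).
split; apply/seteqP; split=> //; last by apply: subset_trans low lowup.
exact: subset_trans lowup up.
Qed.

(** * Resolvent compositions and cocompositions along [L_ n] *)

Section ResolventCompositions.
Context {R : realType} {H G : hilbertType R}.
Variables (L_ : nat -> {linear H -> G}) (L : {linear H -> G}).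
Hypotheses (L_bounded : forall n, bounded_fun_norm (L_ n))
  (Lbounded : bounded_fun_norm L)
  (L_cvg : (fun n => opnorm (L_ n \- L)) @ \oo --> (0 : R))
  (L_le1 : forall n, opnorm (L_ n) <= 1).

Let L_norm n x : `|L_ n x| <= 1 * `|x|.
Proof. by apply: le_trans (ler_opnorm (L_bounded n) x) _; exact: ler_wpM2r. Qed.

Let L_dist n x : `|L_ n x - L x| <= opnorm (L_ n \- L) * `|x|.
Proof.
apply: (@ler_opnorm _ _ _ (L_ n \- L)) => r.
have [M LM] := L_bounded n r; have [N LN] := Lbounded r.
exists (M + N) => y yr /=; apply: le_trans (ler_normB _ _) _.
by rewrite lerD ?LM ?LN.
Qed.

Let L_pointwise x : (fun n => L_ n x) @ \oo --> L x.
Proof.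
apply: (cvgn_dist_le (a := fun n => opnorm (L_ n \- L) * `|x|) (cvg_cst (L x))).
  by rewrite -(mul0r `|x|); apply: cvgM => //; exact: cvg_cst.
by move=> n; exact: L_dist.
Qed.

Let opnorm_dist_ge0 n : 0 <= opnorm (L_ n \- L).
Proof.
have [M LM] := L_bounded n 1; have [N LN] := Lbounded 1.
apply: ub_le_sup; last first.
  by exists 0; rewrite /= ?normr0 // (linear0 (L_ n)) (linear0 L) subrr normr0.
exists (M + N) => _ [y /= y1 <-]; apply: le_trans (ler_normB _ _) _.
by rewrite lerD ?LM ?LN.
Qed.

Variables (J_ : nat -> G -> G) (J : G -> G) (K : R).
Hypotheses (K_ge0 : 0 <= K)
  (J_lip : forall n y y', `|J_ n y - J_ n y'| <= K * `|y - y'|)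
  (J_cvg : forall y, (fun n => J_ n y) @ \oo --> J y).

(** A general [K] serves both cases: compositions use [J_ n], cocompositions use [Id - J_ n] with
    constant [1 + K]. *)
Lemma adjoint_comp_lipschitz n x x' :
  `|(adjoint (L_ n) \o J_ n \o L_ n) x - (adjoint (L_ n) \o J_ n \o L_ n) x'|
    <= K * `|x - x'|.
Proof.
have LL y : `|L_ n y - L_ n y| <= 0 * `|y| by rewrite subrr normr0 mul0r.
apply: le_trans (ler_adjoint_dist _ _ ler01 (lexx 0) (L_norm n) (L_norm n) LL) _.
rewrite mul0r addr0 mul1r; apply: le_trans (J_lip _ _ _) _.
by rewrite ler_wpM2l// -linearB; apply: le_trans (L_norm _ _) _; rewrite mul1r.
Qed.

(** The Lipschitz bound absorbs the moving argument [L_ n x], and convergence in operator norm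
    controls the moving adjoint. *)
Lemma adjoint_comp_cvg x :
  (fun n => (adjoint (L_ n) \o J_ n \o L_ n) x) @ \oo --> (adjoint L \o J \o L) x.
Proof.
pose a n := 1 * `|J_ n (L_ n x) - J (L x)| + opnorm (L_ n \- L) * `|J (L x)|.
have JJ : (fun n => J_ n (L_ n x)) @ \oo --> J (L x).
  apply: (cvgn_dist_le (a := fun n => K * `|L_ n x - L x|) (@J_cvg (L x))).
    rewrite -(mulr0 K); apply: cvgM; first exact: cvg_cst.
    by apply/norm_cvg0P; rewrite -(subrr (L x)); apply: cvgB => //; exact: cvg_cst.
  by move=> n; exact: J_lip.
apply: (cvgn_dist_le (a := a) (cvg_cst _)).
  rewrite -[0]addr0 -[X in X + _](mulr0 1) -[X in _ + X](mul0r `|J (L x)|).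
  apply: cvgD; apply: cvgM => //; try exact: cvg_cst.
  by apply/norm_cvg0P; rewrite -(subrr (J (L x))); apply: cvgB => //; exact: cvg_cst.
move=> n; apply: ler_adjoint_dist ler01 (opnorm_dist_ge0 n) (L_norm n) _ (L_dist n).
exact: ler_opnorm.
Qed.

Lemma resolvent_comp_graph_cvg (C_ : nat -> G -> set G) (C : G -> set G) :
  (forall n, is_resolvent (C_ n) (J_ n)) -> is_resolvent C J ->
  graph_cvg (fun n => resolvent_comp (L_ n) (C_ n)) (resolvent_comp L C).
Proof.
move=> CJ_ CJ; apply: (graph_cvg_of_resolvents _ _ adjoint_comp_lipschitz adjoint_comp_cvg).
  by move=> n; exact: resolvent_comp_is_resolvent.
exact: resolvent_comp_is_resolvent.
Qed.

End ResolventCompositions.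

(** Each of the two inversions replaces a resolvent by [Id] minus it and adds 1 to the Lipschitz
    constant. *)
Lemma resolvent_cocomp_graph_cvg (R : realType) (H G : hilbertType R)
    (L_ : nat -> {linear H -> G}) (L : {linear H -> G})
    (J_ : nat -> G -> G) (J : G -> G) (K : R)
    (C_ : nat -> G -> set G) (C : G -> set G) :
  (forall n, bounded_fun_norm (L_ n)) -> bounded_fun_norm L ->
  (fun n => opnorm (L_ n \- L)) @ \oo --> (0 : R) ->
  (forall n, opnorm (L_ n) <= 1) -> 0 <= K ->
  (forall n y y', `|J_ n y - J_ n y'| <= K * `|y - y'|) ->
  (forall y, (fun n => J_ n y) @ \oo --> J y) ->
  (forall n, is_resolvent (C_ n) (J_ n)) -> is_resolvent C J ->
  graph_cvg (fun n => resolvent_cocomp (L_ n) (C_ n)) (resolvent_cocomp L C).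
Proof.
have lip (V : hilbertType R) (f : V -> V) (N : R) :
    (forall y y', `|f y - f y'| <= N * `|y - y'|) ->
    forall y y', `|(y - f y) - (y' - f y')| <= (1 + N) * `|y - y'|.
  move=> fN y y'; have -> : y - f y - (y' - f y') = (y - y') - (f y - f y').
    by rewrite !opprD !opprK addrACA.
  by apply: le_trans (ler_normB _ _) _; rewrite mulrDl mul1r lerD2l.
move=> L_bd Lbd L_cvg L_le1 K0 J_lip J_cvg CJ_ CJ.
have K1 : 0 <= 1 + K by rewrite addr_ge0.
have J_lip' n := lip _ (J_ n) K (J_lip n).
have J_cvg' y : (fun n => y - J_ n y) @ \oo --> y - J y.
  by apply: cvgB => //; exact: cvg_cst.
have lipT n := lip _ _ _ (adjoint_comp_lipschitz L_bd L_le1 K1 J_lip' n).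
apply: (graph_cvg_of_resolvents _ _ lipT).
- by move=> n; apply/is_resolvent_inv/resolvent_comp_is_resolvent/is_resolvent_inv.
- by apply/is_resolvent_inv/resolvent_comp_is_resolvent/is_resolvent_inv.
- move=> x; apply: cvgB; first exact: cvg_cst.
  exact: (adjoint_comp_cvg L_bd Lbd L_cvg L_le1 J_lip' J_cvg').
Qed.

(** * Strong limits of the resolvents of [gamma n B] *)

Section ResolventLimits.
Context {R : realType} {G : hilbertType R}.
Variables (B : G -> set G) (gamma : nat -> R) (J_ : nat -> G -> G).
Hypotheses (Bmax : maximally_monotone B) (gamma_gt0 : forall n, 0 < gamma n)
  (J_res : forall n, is_resolvent (op_scale (gamma n) B) (J_ n)).

Lemma resolvent_Yosida n y : B (J_ n y) ((gamma n)^-1 *: (y - J_ n y)).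
Proof.
have [b Bb <-] := is_resolvent_gra (J_res n) y.
by rewrite scalerA mulVf ?scale1r// gt_eqF.
Qed.

Lemma resolvent_increment m n y : gamma m <= gamma n ->
  `|J_ m y - J_ n y| ^+ 2 <= `|y - J_ n y| ^+ 2 - `|y - J_ m y| ^+ 2.
Proof.
move=> mn; have /monotoneP mB := Bmax.1.
have := mB _ _ _ _ (resolvent_Yosida m y) (resolvent_Yosida n y).
have -> : J_ m y - J_ n y = (y - J_ n y) - (y - J_ m y).
  by rewrite opprB [RHS]addrC addrA subrK.
move: (y - J_ m y) (y - J_ n y) => p q.
(* The claim is [<| p, q - p |> >= 0]. By monotonicity, this inner product times
   [(gamma m)^-1 - (gamma n)^-1] is at least [(gamma n)^-1] times the squared norm of [q - p], which
   excludes a negative value when [q != p]. *)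
have [/eqP|qp0] := eqVneq (q - p) 0.
  by rewrite subr_eq0 => /eqP->; rewrite !subrr normr0 expr0n.
have : 0 < `|q - p| ^+ 2 by rewrite exprn_gt0 // normr_gt0.
have s0 : 0 < (gamma n)^-1 by rewrite invr_gt0.
have sr : (gamma n)^-1 <= (gamma m)^-1 by rewrite lef_pV2 ?posrE.
rewrite -!inner_norm !innerE [<| q, p |>]innerC => pos mon.
rewrite leNgt; apply/negP => lt.
have pq : 0 < <| p, p |> - <| p, q |> by lra.
have : 0 <= ((gamma m)^-1 - (gamma n)^-1) * (<| p, p |> - <| p, q |>).
  by apply: mulr_ge0; [rewrite subr_ge0|exact: ltW].
have := mulr_gt0 s0 pos.
move=> *; nra.
Qed.

(** Limit of the monotonicity inequality multiplied by [gamma n]. It serves both regimes: either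
    [gamma n] tends to 0, or [b = 0]. *)
Lemma resolvent_limit_angle y p a b :
  (fun n => J_ n y) @ \oo --> p -> B a b ->
  (fun n => gamma n *: b) @ \oo --> (0 : G) -> <| a - p, y - p |> <= 0.
Proof.
move=> Jp Bab gb; have /monotoneP mB := Bmax.1.
have cl : (fun n => <| a - J_ n y, y - J_ n y |>) @ \oo --> <| a - p, y - p |>.
  by apply: cvg_inner; apply: cvgB => //; exact: cvg_cst.
have cr : (fun n => <| a - J_ n y, gamma n *: b |>) @ \oo --> <| a - p, 0 |>.
  by apply: cvg_inner => //; apply: cvgB => //; exact: cvg_cst.
rewrite -(inner0r (a - p)); apply: ler_cvg_to cl cr _; near=> n.
have := mB _ _ _ _ Bab (resolvent_Yosida n y).
rewrite innerDr innerNr -(pmulr_rge0 _ (gamma_gt0 n)) mulrDr mulrN -!innerZr.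
by rewrite scalerA mulfV ?gt_eqF// scale1r => *; lra.
Unshelve. all: by end_near.
Qed.

(** The normal cone condition says that [p] is the projection of [y]: each [J_ n y] is in [dom B],
    and the variational inequality passes from [dom B] to its closure. *)
Lemma resolvent_cvg_dom y : nonincreasing_seq gamma -> gamma @ \oo --> (0 : R) ->
  exists2 p, (fun n => J_ n y) @ \oo --> p & normal_cone (closure (dom B)) p (y - p).
Proof.
move=> gdec g0; pose a n := `|y - J_ n y| ^+ 2.
have inc m n : (m <= n)%N -> `|J_ m y - J_ n y| ^+ 2 <= a m - a n.
  by move=> mn; rewrite distrC; apply/resolvent_increment/gdec.
have adec : nonincreasing_seq a.
  by move=> m n /inc mn; rewrite -subr_ge0; exact: le_trans (sqr_ge0 _) mn.
have ac : cvgn a.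
  by apply: nonincreasing_is_cvgn adec _; exists 0 => _ [n _ <-]; exact: sqr_ge0.
have Jc : cvgn (fun n => J_ n y).
  apply: (@cvgn_sqr_dist _ _ _ (fun n => a n - limn a)).
    by rewrite -(subrr (limn a)); apply: cvgB => //; exact: cvg_cst.
  move=> m n /inc/le_trans; apply; rewrite lerD2l lerN2.
  exact: nonincreasing_cvgn_ge.
exists (limn (fun n => J_ n y)) => //; set p := limn _; split.
  move=> U /Jc [N _ NU]; exists (J_ N y); split; last exact: NU (leqnn N).
  by exists ((gamma N)^-1 *: (y - J_ N y)); exact: resolvent_Yosida.
have domP x : dom B x -> <| x - p, y - p |> <= 0.
  move=> [b Bxb]; apply: resolvent_limit_angle Jc Bxb _.
  by rewrite -(scale0r b); apply: cvgZl.
move=> x xB; apply/ler_addgt0Pl => e e0; rewrite addr0.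
have d0 : 0 < e / (`|y - p| + 1) by rewrite divr_gt0// ltr_wpDl.
have [x' [/domP x'p]] := xB _ (nbhsx_ballx x _ d0).
rewrite -ball_normE /ball_ /= ltr_pdivlMr ?ltr_wpDl// => xx'.
have := cauchy_schwarz (x - x') (y - p); have := normr_ge0 (x - x').
by move: x'p; rewrite !innerE => *; nra.
Qed.

Lemma resolvent_cvg_zer y : nondecreasing_seq gamma -> gamma @ \oo --> +oo ->
  zer B !=set0 ->
  exists2 p, (fun n => J_ n y) @ \oo --> p & normal_cone (zer B) p (y - p).
Proof.
move=> ginc goo [z Bz]; pose a n := `|y - J_ n y| ^+ 2.
have /monotoneP mB := Bmax.1.
have inc m n : (m <= n)%N -> `|J_ m y - J_ n y| ^+ 2 <= a n - a m.
  by move=> mn; apply/resolvent_increment/ginc.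
have ainc : nondecreasing_seq a.
  by move=> m n /inc mn; rewrite -subr_ge0; exact: le_trans (sqr_ge0 _) mn.
have ac : cvgn a.
  (* A zero [z] bounds the distances: monotonicity gives [<| y - J_ n y, J_ n y - z |> >= 0], so
     [J_ n y] is no farther from [y] than [z] is. *)
  apply: nondecreasing_is_cvgn ainc _; exists (`|y - z| ^+ 2) => _ [n _ <-].
  have := mB _ _ _ _ (resolvent_Yosida n y) Bz.
  rewrite subr0 innerZr pmulr_rge0 ?invr_gt0// /a.
  have -> : y - z = (y - J_ n y) + (J_ n y - z) by rewrite addrA subrK.
  move: (y - J_ n y) (J_ n y - z) => d e; have := inner_ge0 e.
  by rewrite -!inner_norm !innerE [<| d, e |>]innerC => *; lra.
have Jc : cvgn (fun n => J_ n y).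
  apply: (@cvgn_sqr_dist _ _ _ (fun n => limn a - a n)).
    by rewrite -(subrr (limn a)); apply: cvgB => //; exact: cvg_cst.
  move=> m n /inc/le_trans; apply; rewrite lerD2r.
  exact: nondecreasing_cvgn_le.
exists (limn (fun n => J_ n y)) => //; set p := limn _; split; last first.
  move=> x Bx; apply: resolvent_limit_angle Jc Bx _.
  by under eq_fun do rewrite scaler0; exact: cvg_cst.
(* The elements [(gamma n)^-1 *: (y - J_ n y)] of [B (J_ n y)] tend to 0, so in the limit [(p, 0)]
   is monotonically related to the graph of [B]. *)
apply: maximally_monotoneP Bmax _ _ _ => x b Bxb.
have gV : (fun n => (gamma n)^-1) @ \oo --> (0 : R).
  apply/(gtr0_cvgV0 (f := gamma)) => //; exact: nearW.
have bc : (fun n => (gamma n)^-1 *: (y - J_ n y) - b) @ \oo --> 0 - b.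
  rewrite -(scale0r (y - p)); apply: cvgB; last exact: cvg_cst.
  by apply: cvgZ => //; apply: cvgB => //; exact: cvg_cst.
have Jxc : (fun n => J_ n y - x) @ \oo --> p - x.
  by apply: cvgB => //; exact: cvg_cst.
apply: cvgr_to_ge (cvg_inner Jxc bc) _; near=> n.
by apply: mB Bxb; exact: resolvent_Yosida.
Unshelve. all: by end_near.
Qed.

End ResolventLimits.

(** * Graph limits in the two regimes *)

Theorem proposition5p9 (R : realType) (H G : hilbertType R)
    (L_ : nat -> {linear H -> G}) (L : {linear H -> G})
    (L_bounded : forall n, bounded_fun_norm (L_ n))
    (Lbounded : bounded_fun_norm L)
    (B : G -> set G) (Bmax : maximally_monotone B)
    (gamma : nat -> R) (gamma_gt0 : forall n, 0 < gamma n)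
    (L_cvg : (fun n => opnorm (L_ n \- L)) @ \oo --> (0 : R))
    (L_le1 : forall n, opnorm (L_ n) <= 1) :
  (nonincreasing_seq gamma -> gamma @ \oo --> (0 : R) ->
    graph_cvg (fun n => resolvent_comp (L_ n) (op_scale (gamma n) B))
      (resolvent_comp L (normal_cone (closure (dom B)))) /\
    graph_cvg (fun n => resolvent_cocomp (L_ n) (op_scale (gamma n) B))
      (resolvent_cocomp L (normal_cone (closure (dom B))))) /\
  (nondecreasing_seq gamma -> gamma @ \oo --> +oo -> zer B !=set0 ->
    graph_cvg (fun n => resolvent_comp (L_ n) (op_scale (gamma n) B))
      (resolvent_comp L (normal_cone (zer B))) /\
    graph_cvg (fun n => resolvent_cocomp (L_ n) (op_scale (gamma n) B))
      (resolvent_cocomp L (normal_cone (zer B)))).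
Proof.
have /choice[J_ J_res] n := resolvent_exists (gamma_gt0 n) Bmax.
have J_lip n y y' : `|J_ n y - J_ n y'| <= 1 * `|y - y'|.
  rewrite mul1r; apply: resolvent_nonexpansive (J_res n) _ _.
  exact: op_scale_monotone Bmax.1.
(* The assumption makes the pointwise limit of [J_ n] the resolvent of [normal_cone C], so each
   regime only has to identify its [C]. *)
have both (C : set G) : (forall y, exists2 p, (fun n => J_ n y) @ \oo --> p &
      normal_cone C p (y - p)) ->
    graph_cvg (fun n => resolvent_comp (L_ n) (op_scale (gamma n) B))
      (resolvent_comp L (normal_cone C)) /\
    graph_cvg (fun n => resolvent_cocomp (L_ n) (op_scale (gamma n) B))
      (resolvent_cocomp L (normal_cone C)).
  move=> lim; have /choice[J JP] : forall y, exists p,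
      (fun n => J_ n y) @ \oo --> p /\ normal_cone C p (y - p).
    by move=> y; have [p] := lim y; exists p.
  have J_cvg y : (fun n => J_ n y) @ \oo --> J y by case: (JP y).
  have CJ : is_resolvent (normal_cone C) J.
    by apply: monotone_is_resolvent (@normal_cone_monotone _ _ C) _ => y; case: (JP y).
  split; first exact: resolvent_comp_graph_cvg ler01 J_lip J_cvg _ _ J_res CJ.
  exact: resolvent_cocomp_graph_cvg J_lip J_cvg J_res CJ.
split=> [gdec g0|ginc goo z].
  by apply: both => y; exact: resolvent_cvg_dom.
by apply: both => y; exact: resolvent_cvg_zer.
Qed.
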